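(* Let $V$ be a finite-dimensional vector space over a field $K$ of characteristic zero. Let $A,B\in\mathrm{End}(V)$ satisfy $A^2=B^2=0$, and suppose that $\mathrm{tr}(AB)\in K$ is transcendental over $\mathbb{Q}$. Then the endomorphisms $1+A$ and $1+B$ generate a free subgroup of rank $2$ in $\mathrm{Aut}(V)$.
   Context: Here $\mathrm{End}(V)$ and $\mathrm{Aut}(V)$ denote the $K$-linear endomorphisms and automorphisms of $V$, and $1$ is the identity map. *)

(* Defs.v *)
From HB Require Import structures.
From mathcomp Require Import all_boot all_order all_algebra.

Set Implicit Arguments.
Unset Strict Implicit.
Unset Printing Implicit Defensive.

Import GRing.Theory.
Local Open Scope ring_scope.

(* The free group on T: reduced words in the letters x = (x, false) and
   x^-1 = (x, true), multiplied by concatenation followed by reduction. *)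
Section FreeGroup.

Variable T : choiceType.
Local Notation letter := (T * bool)%type.

Definition flip (a : letter) : letter := (a.1, ~~ a.2).

Definition reduced (w : seq letter) : bool :=
  sorted (fun a b => b != flip a) w.

Definition cons_reduce (a : letter) (w : seq letter) : seq letter :=
  if w is b :: w' then if b == flip a then w' else a :: w else [:: a].

Definition word_mul (u v : seq letter) : seq letter := foldr cons_reduce v u.

Definition word_inv (w : seq letter) : seq letter := rev (map flip w).

Lemma flipK : involutive flip.
Proof. by case=> x b; rewrite /flip /= negbK. Qed.

Lemma cons_reduce_reduced a w : reduced w -> reduced (cons_reduce a w).
Proof.
case: w => [|b w] //= bw; case: eqP => [_|/eqP neq_ba]; first exact: path_sorted bw.
by rewrite /reduced /= neq_ba.
Qed.

Lemma cons_reduceK a w :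
  reduced w -> cons_reduce a (cons_reduce (flip a) w) = w.
Proof.
case: w => [|b w] /=; first by rewrite eqxx.
rewrite flipK; case: (b =P a) => [->|_]; last by rewrite /= eqxx.
by case: w => [|c w] //=; rewrite /reduced /= => /andP[/negPf->].
Qed.

Lemma word_mul_reduced u v : reduced v -> reduced (word_mul u v).
Proof. by move=> rv; elim: u => //= a u IHu; apply: cons_reduce_reduced. Qed.

Lemma word_inv_reduced w : reduced w -> reduced (word_inv w).
Proof.
rewrite /reduced /word_inv rev_sorted sorted_map; apply: sub_sorted => a b /=.
by rewrite flipK eq_sym.
Qed.

Lemma word_mulw1 w : reduced w -> word_mul w [::] = w.
Proof.
elim: w => //= a w IHw aw; rewrite IHw; last exact: path_sorted aw.
by case: w aw {IHw} => [|b w] //= /andP[/negPf->].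
Qed.

Lemma word_mul_cons a u w :
  reduced w -> word_mul (cons_reduce a u) w = cons_reduce a (word_mul u w).
Proof.
case: u => [|b u] //= rw; case: eqP => [->|//] /=.
by rewrite cons_reduceK // word_mul_reduced.
Qed.

Lemma word_mulA u v w :
  reduced w -> word_mul u (word_mul v w) = word_mul (word_mul u v) w.
Proof. by move=> rw; elim: u => //= a u ->; rewrite word_mul_cons. Qed.

Lemma word_mulV w : word_mul (word_inv w) w = [::].
Proof.
elim: w => //= a w IHw; rewrite /word_inv /= rev_cons /word_mul foldr_rcons /=.
by rewrite flipK eqxx.
Qed.

Lemma word_invK : involutive word_inv.
Proof. by move=> w; rewrite /word_inv map_rev revK mapK //; apply: flipK. Qed.

Record free_group := FreeGroup { word :> seq letter; _ : reduced word }.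

HB.instance Definition _ := [isSub for word].
HB.instance Definition _ := [Choice of free_group by <:].

Implicit Types u v w : free_group.

Lemma wordP w : reduced w. Proof. exact: (valP w). Qed.

Definition fg_one : free_group := FreeGroup (isT : reduced [::]).
Definition fg_mul u v : free_group :=
  FreeGroup (word_mul_reduced u (wordP v)).
Definition fg_inv w : free_group := FreeGroup (word_inv_reduced (wordP w)).

Fact fg_mulA : associative fg_mul.
Proof. by move=> u v w; apply: val_inj; apply: word_mulA (wordP w). Qed.
Fact fg_mul1g : left_id fg_one fg_mul.
Proof. by move=> w; apply: val_inj. Qed.
Fact fg_mulg1 : right_id fg_one fg_mul.
Proof. by move=> w; apply: val_inj; apply: word_mulw1 (wordP w). Qed.
Fact fg_mulVg : left_inverse fg_one fg_inv fg_mul.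
Proof. by move=> w; apply: val_inj; apply: word_mulV. Qed.
Fact fg_mulgV : right_inverse fg_one fg_inv fg_mul.
Proof.
move=> w; apply: val_inj => /=.
by rewrite -[X in word_mul X]word_invK word_mulV.
Qed.

HB.instance Definition _ := isGroup.Build free_group
  fg_mulA fg_mul1g fg_mulg1 fg_mulVg fg_mulgV.

Definition fg_gen (x : T) : free_group :=
  FreeGroup (isT : reduced [:: (x, false)]).

Section Universal.

Variables (G : groupType) (f : T -> G).

Definition letter_eval (a : letter) : G :=
  if a.2 then ((f a.1)^-1)%g else f a.1.

Definition word_eval (w : seq letter) : G :=
  foldr (fun a g => (letter_eval a * g)%g) 1%g w.

Definition fg_eval (w : free_group) : G := word_eval w.

Lemma letter_eval_flip a : letter_eval (flip a) = ((letter_eval a)^-1)%g.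
Proof. by case: a => x [] //=; rewrite /letter_eval /= invgK. Qed.

Fact fg_eval_mul : {morph fg_eval : u v / (u * v)%g}.
Proof.
move=> [u ru] [v rv]; rewrite /fg_eval /= {ru rv}.
elim: u => [|a u IHu] /=; first by rewrite mul1g.
rewrite -mulgA -IHu; case: (word_mul u v) => [|b w] //=.
by case: eqP => [->|//]; rewrite letter_eval_flip mulVKg.
Qed.

Fact fg_eval_one : fg_eval 1%g = 1%g. Proof. by []. Qed.

HB.instance Definition _ := isMultiplicative.Build _ _ fg_eval fg_eval_mul.
HB.instance Definition _ :=
  Multiplicative_isUMagmaMorphism.Build _ _ fg_eval fg_eval_one.

Lemma fg_eval_gen x : fg_eval (fg_gen x) = f x.
Proof. by rewrite /fg_eval /= mulg1. Qed.

Lemma fg_eval_unique (phi : {multiplicative free_group -> G}) :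
  (forall x, phi (fg_gen x) = f x) -> phi =1 fg_eval.
Proof.
move=> phi_gen; have phi1 : phi 1%g = 1%g.
  by apply: (mulgI (phi 1%g)); rewrite -gmulfM !mulg1.
have phiV u : phi (u^-1)%g = ((phi u)^-1)%g.
  by apply: (mulgI (phi u)); rewrite -gmulfM !mulgV phi1.
case; elim=> [|a w IHw] rw.
  by rewrite -[RHS]phi1; congr (phi _); apply: val_inj.
have rw' : reduced w by apply: path_sorted rw.
have ra : reduced [:: a] by [].
have -> : FreeGroup rw = (FreeGroup ra * FreeGroup rw')%g.
  apply: val_inj => /=; case: w rw {IHw rw'} => [|b w] //=.
  by rewrite /reduced /= => /andP[/negPf->].
rewrite gmulfM fg_eval_mul IHw; congr (_ * _)%g; rewrite /fg_eval /= mulg1.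
case: a ra {rw} => x [] ra; rewrite /letter_eval /= -phi_gen.
  by rewrite -phiV; congr (phi _); apply: val_inj.
by congr (phi _); apply: val_inj.
Qed.

End Universal.

End FreeGroup.

Definition generated (G : groupType) (S : G -> Prop) (g : G) : Prop :=
  forall H : G -> Prop,
    (forall x, S x -> H x) ->
    H 1%g ->
    (forall x y, H x -> H y -> H (x * y)%g) ->
    (forall x, H x -> H (x^-1)%g) ->
  H g.

Definition free_of_rank (n : nat) (G : groupType) (H : G -> Prop) : Prop :=
  exists phi : {multiplicative free_group 'I_n -> G},
    injective phi /\ forall g, H g <-> exists w, phi w = g.

Section LinearMaps.

Variables (K : fieldType) (V : vectType K).

(* Aut(V); the product is composition. *)
Record lin_aut := LinAut { aut_fun :> 'End(V); _ : lker aut_fun == 0%VS }.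

HB.instance Definition _ := [isSub for aut_fun].
HB.instance Definition _ := [Choice of lin_aut by <:].

Implicit Types f g h : lin_aut.

Lemma lin_aut_ker f : lker f == 0%VS. Proof. exact: (valP f). Qed.

Lemma lker0_linv (f g : 'End(V)) : (g \o f = \1)%VF -> lker f == 0%VS.
Proof.
move=> gf; apply/lker0P => x y fxy.
by rewrite -[x]id_lfunE -[y]id_lfunE -gf !comp_lfunE fxy.
Qed.

Fact lin_aut_one_ker : lker (\1%VF : 'End(V)) == 0%VS.
Proof. by apply: (@lker0_linv _ \1%VF); rewrite comp_lfun1l. Qed.
Fact lin_aut_mul_ker f g : lker (f \o g)%VF == 0%VS.
Proof.
apply/lker0P => x y; rewrite !comp_lfunE.
by move=> /(lker0P (lin_aut_ker f)) /(lker0P (lin_aut_ker g)).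
Qed.
Fact lin_aut_inv_ker f : lker (f^-1)%VF == 0%VS.
Proof. by apply: (@lker0_linv _ f); apply: lker0_compfV (lin_aut_ker f). Qed.

Definition lin_aut_one := LinAut lin_aut_one_ker.
Definition lin_aut_mul f g := LinAut (lin_aut_mul_ker f g).
Definition lin_aut_inv f := LinAut (lin_aut_inv_ker f).

Fact lin_aut_mulA : associative lin_aut_mul.
Proof. by move=> f g h; apply: val_inj; apply: comp_lfunA. Qed.
Fact lin_aut_mul1g : left_id lin_aut_one lin_aut_mul.
Proof. by move=> f; apply: val_inj; apply: comp_lfun1l. Qed.
Fact lin_aut_mulg1 : right_id lin_aut_one lin_aut_mul.
Proof. by move=> f; apply: val_inj; apply: comp_lfun1r. Qed.
Fact lin_aut_mulVg : left_inverse lin_aut_one lin_aut_inv lin_aut_mul.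
Proof.
by move=> f; apply: val_inj; apply: lker0_compVf (lin_aut_ker f).
Qed.
Fact lin_aut_mulgV : right_inverse lin_aut_one lin_aut_inv lin_aut_mul.
Proof.
by move=> f; apply: val_inj; apply: lker0_compfV (lin_aut_ker f).
Qed.

HB.instance Definition _ := isGroup.Build lin_aut
  lin_aut_mulA lin_aut_mul1g lin_aut_mulg1 lin_aut_mulVg lin_aut_mulgV.

Fact one_plus_ker (A : 'End(V)) :
  (A \o A)%VF = 0 -> lker (\1%VF + A) == 0%VS.
Proof.
move=> AA0; apply: (@lker0_linv _ (\1%VF - A)).
rewrite comp_lfunDl comp_lfunNl !comp_lfunDr AA0 comp_lfun1l comp_lfun1r.
by rewrite addr0 comp_lfun1l addrK.
Qed.

Definition one_plus (A : 'End(V)) (AA0 : (A \o A)%VF = 0) : lin_aut :=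
  LinAut (one_plus_ker AA0).

Definition lfun_trace (A : 'End(V)) : K :=
  \tr (passmx.mxof (vbasis {:V}) (vbasis {:V}) A).

Lemma lfun_trace_basis (e : (\dim {:V}).-tuple V) (A : 'End(V)) :
  basis_of {:V} e -> lfun_trace A = \tr (passmx.mxof e e A).
Proof.
move=> eB; have bB := vbasisP {:V}.
have comp (e1 e2 e3 : (\dim {:V}).-tuple V) (f g : 'End(V)) :
    basis_of {:V} e2 ->
    passmx.mxof e1 e3 (g \o f)%VF = passmx.mxof e1 e2 f *m passmx.mxof e2 e3 g.
  move=> e2B; apply/row_matrixP => i; rewrite row_mul !rowE !passmx.mul_mxof.
  by rewrite comp_lfunE passmx.rVofK.
rewrite /lfun_trace -[in LHS](comp_lfun1r A) (comp _ e _ \1%VF A eB) mxtrace_mulC.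
by rewrite -(comp e _ e A \1%VF bB) comp_lfun1l.
Qed.

End LinearMaps.

(* Main.v *)
Require Import Defs.
From Stdlib Require Import Classical.
From HB Require Import structures.
From mathcomp Require Import all_boot all_order all_algebra all_field.
From mathcomp Require Import ring lra.

Set Implicit Arguments.
Unset Strict Implicit.
Unset Printing Implicit Defensive.

Import GRing.Theory Num.Theory.
Local Open Scope ring_scope.

(** Put a = A, b = B and z = ab.  It must be shown that no nonempty reduced
word W in 1 + a, 1 + b and their inverses 1 - a, 1 - b is the identity.

Since a^2 = b^2 = 0, a product a W b is a polynomial in z without constant
term, and b W b is b times such a polynomial.  More precisely, for
c = (3 + a) b one has
  a W c = P(z) z   and   b W c = b Q(z) z
where the pair (P, Q) of polynomials over the rationals is obtained from
(3, 1) by letting the letters of W act through the matrices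
  (1 + a)^(+-1) : (P, Q) |-> (P, Q +- P),
  (1 + b)^(+-1) : (P, Q) |-> (P +- X Q, Q)
of SL_2(Z[X]) ([unipotent_word_act]).  So W = 1 forces (P - 3) X and
(Q - 1) X^2 to vanish at z.

Now z is a root of no nonzero rational polynomial p: over an extension of K in
which the characteristic polynomial of z splits, the eigenvalues of z would be
roots of p, hence algebraic over the rationals, and so would be their sum
tr(AB) ([trace_algebraic]).  Therefore (P, Q) = (3, 1): the word fixes the
vector (3, 1) under the action on pairs of polynomials, hence also after
specialising X to 9.  There the action is, up to rescaling the second
coordinate, that of two Sanov matrices with off-diagonal entry 3, and ping-pong
shows that only the empty word fixes (3, 1) ([word_act_fixed]).

Working with a W c and b W c, and not with the restriction of W to a plane
spanned by an eigenvector v of ab and by bv, keeps everything over K except for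
the algebraicity of the trace; and the vector (3, 1), which lies in neither
ping-pong basin, makes it unnecessary to conjugate W to a cyclically reduced
word. *)

(** * Rational numbers in a field of characteristic zero *)

Section Ratr.
Variables (K : fieldType) (charK0 : [pchar K] =i pred0).

Let intr_neq0 (m : int) : m != 0 -> m%:~R != 0 :> K.
Proof.
have natr_neq0 k : (k != 0)%N -> k%:R != 0 :> K.
  by move=> k_neq0; rewrite ((pcharf0P K).1 charK0).
case: m => n; first exact: (natr_neq0 n).
by rewrite NegzE mulrNz !oppr_eq0 => _; apply: (natr_neq0 n.+1).
Qed.

Let den_neq0 x : (denq x)%:~R != 0 :> K.
Proof. by rewrite intr_neq0 ?denq_neq0. Qed.

Let ratr_frac (m d : int) : d != 0 -> ratr (m%:~R / d%:~R) = m%:~R / d%:~R :> K.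
Proof.
move=> d0; apply/eqP; rewrite /ratr eqr_div ?intr_neq0 ?denq_neq0 //.
set x : rat := _ / _.
suff /(congr1 (fun k : int => k%:~R : K)) : numq x * d = m * denq x.
  by rewrite !rmorphM /= => ->.
apply: (@intr_inj rat); rewrite !rmorphM /= [LHS]mulrC.
have {1}-> : (numq x)%:~R = x * (denq x)%:~R.
  by rewrite -{2}(divq_num_den x) divfK // intr_eq0 denq_neq0.
by rewrite mulrA /x mulrCA divff ?intr_eq0 // mulr1.
Qed.

(** The canonical ring morphism structure on [ratr] asks for an ordered target,
whereas here K is an arbitrary field of characteristic zero. *)
Lemma ratr_zmod_morphism_pchar0 : zmod_morphism (ratr : rat -> K).
Proof.
move=> x y; rewrite -{1}[x]divq_num_den -{1}[y]divq_num_den -mulNr.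
rewrite addf_div ?intr_eq0 ?denq_neq0 // -rmorphN -!rmorphM -rmorphD /=.
rewrite ratr_frac ?mulf_neq0 ?denq_neq0 // rmorphD !rmorphM rmorphN /=.
by rewrite -addf_div // mulNr.
Qed.

Lemma ratr_monoid_morphism_pchar0 : monoid_morphism (ratr : rat -> K).
Proof.
split=> [|x y]; first exact: (ratr_int K 1).
rewrite -{1}[x]divq_num_den -{1}[y]divq_num_den mulf_div -!rmorphM /=.
by rewrite ratr_frac ?mulf_neq0 ?denq_neq0 // !rmorphM /= -mulf_div.
Qed.

End Ratr.

(** * Algebraicity of the trace *)

(** Irreducibility over an arbitrary field is undecidable, hence the appeal to
excluded middle. *)
Lemma irreducible_factor (F : fieldType) (p : {poly F}) :
  (1 < size p)%N -> exists2 r, irreducible_poly r & r %| p.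
Proof.
have [n] := ubnP (size p); elim: n p => // n IHn p lt_p_n p_gt1.
have [|red_p] := classic (irreducible_poly p); first by exists p.
have [q /and3P[q_neq1 q_dv_p neq_q_p]] :
    exists q : {poly F}, [&& size q != 1%N, q %| p & ~~ (q %= p)].
  apply: NNPP => no_q; apply: red_p; split=> // q q_neq1 q_dv_p.
  apply/negPn/negP => neq_q_p.
  by case: no_q; exists q; rewrite q_neq1 q_dv_p.
have p_neq0 : p != 0 by rewrite -size_poly_gt0 ltnW.
have q_gt0 : (0 < size q)%N by rewrite size_poly_gt0 (dvdpN0 q_dv_p).
have lt_q_p : (size q < size p)%N.
  by rewrite ltn_neqAle dvdp_leq // dvdp_size_eqp // neq_q_p.
have [||r irr_r r_dv_q] := IHn q.
- exact: leq_trans lt_q_p _.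
- by rewrite ltn_neqAle eq_sym q_neq1.
by exists r => //; apply: dvdp_trans q_dv_p.
Qed.

(** Adjoin one root at a time; the extension is presented by an embedding, so
that the successive embeddings simply compose. *)
Lemma splitting_extension (F : fieldType) (p : {poly F}) : p \is monic ->
  exists (L : fieldType) (iota : {rmorphism F -> L}) (rs : seq L),
    map_poly iota p = \prod_(x <- rs) ('X - x%:P).
Proof.
have [n] := ubnP (size p); elim: n F p => // n IHn F p lt_p_n mon_p.
have [p_le1|p_gt1] := leqP (size p) 1.
  exists F, idfun, [::]; rewrite big_nil map_poly_id //.
  have p_eq1 : size p == 1%N.
    by rewrite eqn_leq p_le1 size_poly_gt0 monic_neq0.
  have /size_poly1P[c _ Dp] := p_eq1.
  by move: mon_p; rewrite Dp monicE lead_coefC => /eqP->.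
have [r irr_r r_dv_p] := irreducible_factor p_gt1.
have [L _ [x rx0 _]] := irredp_FAdjoin irr_r.
pose j : {rmorphism F -> L} := in_alg L.
have /factor_theorem[q Dq] : root (map_poly j p) x.
  by apply: root_dvdp rx0; rewrite dvdp_map.
have mon_q : q \is monic.
  by rewrite -(monicMr _ (monicXsubC x)) -Dq monic_map.
have [|L' [k [rs Drs]]] := IHn L q _ mon_q.
  rewrite -ltnS (leq_trans _ lt_p_n) // -(size_map_poly j) Dq.
  by rewrite size_Mmonic ?monicXsubC ?monic_neq0 // size_XsubC addn2.
exists L', (k \o j), (rcons rs (k x)).
rewrite map_poly_comp /= Dq rmorphM /= Drs rmorphB /= map_polyX map_polyC /=.
by rewrite -cats1 big_cat big_seq1.
Qed.

(** The trace is the sum of the eigenvalues in a splitting field, and each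
eigenvalue is a root of p because it is a root of the minimal polynomial. *)
Lemma trace_algebraic (F K : fieldType) (f : {rmorphism F -> K}) (n : nat)
    (Z : 'M[K]_n.+1) (p : {poly F}) :
  p != 0 -> horner_mx Z (map_poly f p) = 0 -> algebraicOver f (\tr Z).
Proof.
move=> p_neq0 pZ0.
have [L [iota [rs Drs]]] := splitting_extension (char_poly_monic Z).
pose g : {rmorphism F -> L} := iota \o f.
have rs_alg x : x \in rs -> algebraicOver g x.
  move=> rs_x; exists p => //; rewrite map_poly_comp /=.
  have : root (char_poly (map_mx iota Z)) x.
    by rewrite -map_char_poly Drs root_prod_XsubC.
  rewrite -root_mxminpoly; apply: root_dvdp.
  by rewrite mxminpoly_map dvdp_map; apply: mxminpoly_min.
have sum_alg : algebraicOver g (\sum_(x <- rs) x).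
  rewrite big_seq; elim/big_ind: _ => [|x y|x /rs_alg//].
    exact: algebraic0.
  exact: algebraic_add.
have size_rs : size rs = n.+1.
  apply: succn_inj; rewrite -(size_prod_XsubC _ id) -Drs.
  by rewrite size_map_poly size_char_poly.
have Dtr : iota (\tr Z) = \sum_(x <- rs) x.
  apply: oppr_inj; rewrite -rmorphN -char_poly_trace // -coef_map Drs.
  by rewrite -coefPn_prod_XsubC size_rs.
have [q q_neq0] := sum_alg; rewrite -Dtr map_poly_comp /= fmorph_root => qr.
by exists q.
Qed.

(** * A free action on pairs of numbers *)

Section LetterAction.

Variables (S : comNzRingType) (t : S).

(** The letters (0, _) and (1, _) act by the elementary matrices with lower
left entry 1 and upper right entry t, or by their inverses. *)
Definition letter_act (l : 'I_2 * bool) (v : S * S) : S * S :=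
  if l.1 == 0 then (v.1, v.2 + (-1) ^+ l.2 * v.1)
  else (v.1 + (-1) ^+ l.2 * t * v.2, v.2).

Definition word_act (w : seq ('I_2 * bool)) (v : S * S) : S * S :=
  foldr letter_act v w.

End LetterAction.

Lemma rmorph_word_act (S S' : comNzRingType) (g : {rmorphism S -> S'}) t w v :
  word_act (g t) w (g v.1, g v.2) =
    (g (word_act t w v).1, g (word_act t w v).2).
Proof.
elim: w => //= l w ->; rewrite /letter_act /=.
by case: (l.1 == 0); rewrite /= rmorphD !rmorphM rmorph_sign.
Qed.

Lemma ord2_neq0_eq (i j : 'I_2) : i != 0 -> j != 0 -> i = j.
Proof.
by case: i j => [[|[|i]] //= Hi] [[|[|j]] //= Hj] _ _; apply: val_inj.
Qed.

Section PingPong.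

Variable S : realFieldType.
Implicit Types (x y s : S) (w : seq ('I_2 * bool)).

(** Ping-pong for t = 9 in the coordinates (x, y) = (P, 3 Q), where both kinds
of letters add 3 or -3 times one coordinate to the other.  The basin of
a letter is the set where the coordinate just modified strictly dominates the
other one and where x y has the sign of the letter.  The sign records which of
the two inverse letters came last, so that the induction can run on single
letters and not on powers. *)
Lemma repeated_letter_dominates (b : bool) x y :
  x ^+ 2 < (-1) ^+ b * x * y ->
  x ^+ 2 < (-1) ^+ b * x * (y + 3 * ((-1) ^+ b * x)).
Proof. by case: b; rewrite ?expr1 ?expr0; nra. Qed.

Lemma new_letter_dominates (b c : bool) x y :
  y ^+ 2 < (-1) ^+ c * x * y ->
  x ^+ 2 < (-1) ^+ b * x * (y + 3 * ((-1) ^+ b * x)).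
Proof.
(* The square gives 2 |x y| <= x^2 + y^2, and y^2 < |x y|: hence |x y| < x^2. *)
move=> yx; have := sqr_ge0 (x - (-1) ^+ c * y).
by move: yx; case: b; case: c; rewrite ?expr1 ?expr0; nra.
Qed.

(** The starting point (3, 1) has x = y = 3: it is on the boundary of the
basins, and any letter sends it into its own basin. *)
Lemma word_act_basin l w : reduced (l :: w) ->
  let: (x, y) := word_act (9 : S) (l :: w) (3, 1) in
  if l.1 == 0 then x ^+ 2 < (-1) ^+ l.2 * x * (3 * y)
  else (3 * y) ^+ 2 < (-1) ^+ l.2 * (3 * y) * x.
Proof.
elim: w l => [|l' w IHw] l.
  move=> _; rewrite /= /letter_act.
  by case: (l.1 == 0); case: l.2; rewrite /= ?expr1 ?expr0; lra.
case/andP=> l'_l rw; have {IHw rw} := IHw l' rw.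
rewrite -[word_act _ (l :: _) _]/(letter_act 9 l (word_act 9 (l' :: w) _)).
case: (word_act _ _ _) => x y; rewrite /letter_act /=.
have same : (l'.1 == l.1) -> l'.2 = l.2.
  move=> /eqP l1; move: l'_l; rewrite /flip -l1; case: (l') (l) => i b [j c] /=.
  by rewrite xpair_eqE eqxx /=; case: b c => [] [].
have Dy b : 3 * (y + (-1) ^+ b * x) = 3 * y + 3 * ((-1) ^+ b * x).
  by rewrite mulrDr.
have Dx b : x + (-1) ^+ b * 9 * y = x + 3 * ((-1) ^+ b * (3 * y)) by ring.
have [l0|l_n0] := eqVneq l.1 0; have [l'0|l'_n0] := eqVneq l'.1 0;
  rewrite /= ?Dy ?Dx.
- by rewrite same ?l0 ?l'0 //; apply: repeated_letter_dominates.
- by rewrite [X in _ < X -> _]mulrAC; apply: new_letter_dominates.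
- by rewrite [X in _ < X -> _]mulrAC; apply: new_letter_dominates.
- rewrite same ?(ord2_neq0_eq l'_n0 l_n0) //; exact: repeated_letter_dominates.
Qed.

Lemma word_act_fixed w :
  reduced w -> word_act 9 w (3, 1) = (3, 1) :> S * S -> w = [::].
Proof.
case: w => // l w /word_act_basin + fix_w; rewrite {}fix_w /=.
by case: ifP => _ h; exfalso; move: h; case: l.2;
  rewrite ?expr1 ?expr0 => h; clear -h; lra.
Qed.

End PingPong.

(** * Words in two square-zero perturbations of the identity *)

Section UnipotentWords.

Variables (R : pzRingType) (a b : R).

Definition unipotent_letter (l : 'I_2 * bool) : R :=
  1 + (-1) ^+ l.2 * (if l.1 == 0 then a else b).

Definition unipotent_word (w : seq ('I_2 * bool)) : R :=
  foldr (fun l W => unipotent_letter l * W) 1 w.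

Hypotheses (aa0 : a * a = 0) (bb0 : b * b = 0).

Variables (S : comNzRingType) (t : S) (f : {rmorphism S -> R}).
Hypothesis Dab : f t = a * b.

(** The mixed relations a W c = f(P t) and b W c = b f(Q t) are stable under
adding a letter on the left of W: in a (1 + a) and b (1 + b) the extra term is
zero, while a (1 + b) W c = a W c + ab f(Q t) with ab = f(t), and
b (1 + a) W c = b W c + b f(P t). *)
Lemma unipotent_word_act (c : R) (v : S * S) w :
    a * c = f (v.1 * t) -> b * c = b * f (v.2 * t) ->
  a * (unipotent_word w * c) = f ((word_act t w v).1 * t) /\
  b * (unipotent_word w * c) = b * f ((word_act t w v).2 * t).
Proof.
move=> ac bc; elim: w => [|l w [IHa IHb]] /=; first by rewrite mul1r.
set W := unipotent_word w in IHa IHb *.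
rewrite /unipotent_letter /letter_act -!mulrA mulrDl mul1r !mulrDr IHa IHb.
have sgC (x y : R) : x * ((-1) ^+ l.2 * y) = (-1) ^+ l.2 * (x * y).
  by rewrite !mulrA commr_sign.
case: (l.1 == 0) => /=; rewrite -!mulrA !sgC.
  rewrite (mulrA a a) aa0 mul0r mulr0 addr0; split=> //.
  by rewrite IHa mulrDl -!mulrA [in RHS]rmorphD [in RHS]rmorphMsign mulrDr sgC.
rewrite (mulrA b b) bb0 mul0r mulr0 addr0; split=> //.
rewrite IHb mulrA -Dab -rmorphM -rmorphMsign -rmorphD; congr (f _).
by rewrite mulrDl !mulrA.
Qed.

End UnipotentWords.

(** Injectivity of f says that ab is transcendental over F; it transports the
equation W = 1 to polynomials, where the indeterminate can be specialised. *)
Lemma unipotent_word_eq1 (F : realFieldType) (R : pzRingType) (a b : R)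
    (f : {rmorphism {poly F} -> R}) w :
    a * a = 0 -> b * b = 0 -> f 'X = a * b -> injective f -> reduced w ->
  unipotent_word a b w = 1 -> w = [::].
Proof.
move=> aa0 bb0 Dab inj_f rw w1.
(* With c = (3 + a) b the empty word corresponds to the pair (3, 1). *)
pose v : {poly F} * {poly F} := (3, 1); pose c : R := (3 + a) * b.
have ac : a * c = f (v.1 * 'X).
  rewrite /c /v rmorphM rmorph_nat Dab mulrDl mulrDr !mulrA aa0 mul0r addr0.
  by rewrite [a * 3]mulr_natr -[RHS]mulrA mulr_natl mulrnAl.
have bc : b * c = b * f (v.2 * 'X).
  rewrite /c /v mul1r Dab mulrDl mulrDr mulrA [b * 3]mulr_natr mulrnAl bb0.
  by rewrite mul0rn add0r.
have [] := unipotent_word_act aa0 bb0 Dab w ac bc.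
(* The relation for b is multiplied by a, which turns b into ab = f 'X. *)
rewrite w1 mul1r ac bc => /inj_f eqP /(congr1 ( *%R a)).
rewrite !mulrA -Dab -!rmorphM => /inj_f eqQ; apply: (@word_act_fixed F) => //.
have X_neq0 : 'X != 0 :> {poly F} by rewrite polyX_eq0.
have fix_v : word_act 'X w v = v.
  have {}eqP := mulIf X_neq0 eqP; have {}eqQ := mulIf X_neq0 (mulfI X_neq0 eqQ).
  by rewrite [LHS]surjective_pairing -eqP -eqQ.
pose ev : {rmorphism {poly F} -> F} := horner_eval 9.
have := rmorph_word_act ev 'X w v; rewrite fix_v /= /horner_eval.
have h1 : (1 : {poly F}).[9] = 1 := hornerC 1 9.
by rewrite hornerX hornerMn h1.
Qed.

Lemma matrix_word_eq1 (K : fieldType) (charK0 : [pchar K] =i pred0) (n : nat)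
    (a b : 'M[K]_n) (w : seq ('I_2 * bool)) :
    a * a = 0 -> b * b = 0 ->
    ~ algebraicOver (ratr : rat -> K) (\tr (a * b)) -> reduced w ->
  unipotent_word a b w = 1 -> w = [::].
Proof.
pose qK : {rmorphism rat -> K} := HB.pack (ratr : rat -> K)
  (GRing.isZmodMorphism.Build _ _ _ (ratr_zmod_morphism_pchar0 charK0))
  (GRing.isMonoidMorphism.Build _ _ _ (ratr_monoid_morphism_pchar0 charK0)).
rewrite -[ratr]/(qK : rat -> K).
case: n a b => [|n] a b aa0 bb0 tr_ab rw.
  by case: tr_ab; rewrite /mxtrace big_ord0; apply: algebraic0.
pose ev : {rmorphism {poly rat} -> 'M[K]_n.+1} :=
  horner_mx (a * b) \o map_poly qK.
apply: (@unipotent_word_eq1 rat _ _ _ ev) => //.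
  rewrite -[LHS]/(horner_mx (a * b) (map_poly qK 'X)).
  by rewrite (map_polyX qK) horner_mx_X.
apply: raddf_inj => p evp0; apply/eqP/negPn/negP => p_neq0.
by case: tr_ab; apply: trace_algebraic p_neq0 evp0.
Qed.

(** * From automorphisms to matrices *)

Section AutMatrix.

Variables (K : fieldType) (V : vectType K).

(** Matrices in [passmx] act on row vectors, so composition is reversed; the
transpose restores the order of the factors. *)
Definition end_mx (h : 'End(V)) : 'M[K]_(\dim {:V}) :=
  (passmx.mxof (vbasis {:V}) (vbasis {:V}) h)^T.

Lemma end_mxD h k : end_mx (h + k) = end_mx h + end_mx k.
Proof.
by rewrite /end_mx -[in LHS](scale1r h) passmx.mxof_linear scale1r raddfD.
Qed.

Lemma end_mx0 : end_mx 0 = 0.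
Proof. by apply: (addIr (end_mx 0)); rewrite -end_mxD !add0r. Qed.

Lemma end_mx1 : end_mx \1%VF = 1.
Proof. by rewrite /end_mx passmx.mxof1 ?trmx1 // (basis_free (vbasisP _)). Qed.

Lemma end_mx_comp h k : end_mx (h \o k)%VF = end_mx h * end_mx k.
Proof.
by rewrite /end_mx (passmx.mxof_comp _ _ (vbasisP {:V})) trmx_mul.
Qed.

Lemma end_mx_trace h : \tr (end_mx h) = lfun_trace h.
Proof. by rewrite /end_mx mxtrace_tr. Qed.

Variables (A B : 'End(V)) (hA : (A \o A)%VF = 0) (hB : (B \o B)%VF = 0).

Definition unipotent_gen (i : 'I_2) : lin_aut V :=
  if i == 0 then one_plus hA else one_plus hB.

Lemma end_mx_one_plusV (C : 'End(V)) (hC : (C \o C)%VF = 0) :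
  end_mx (one_plus hC)^-1%g = 1 - end_mx C.
Proof.
have CC0 : end_mx C * end_mx C = 0 by rewrite -end_mx_comp hC end_mx0.
have DC : end_mx (one_plus hC) = 1 + end_mx C by rewrite end_mxD end_mx1.
have : end_mx (one_plus hC)^-1%g * end_mx (one_plus hC) = 1.
  rewrite -end_mx_comp -end_mx1.
  have mulV1 := congr1 (fun g : lin_aut V => end_mx g)
    (lin_aut_mulVg (one_plus hC)).
  exact: mulV1.
move/(congr1 ( *%R^~ (1 - end_mx C))); rewrite mul1r -mulrA DC.
by rewrite mulrDl mul1r mulrBr mulr1 CC0 subr0 subrK mulr1.
Qed.

Lemma end_mx_word_eval w :
  end_mx (word_eval unipotent_gen w) = unipotent_word (end_mx A) (end_mx B) w.
Proof.
elim: w => [|l w IHw]; first exact: end_mx1.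
rewrite [LHS]end_mx_comp IHw; congr (_ * _).
rewrite /letter_eval /unipotent_gen /unipotent_letter mulr_sign.
by case: (l.1 == 0); case: l.2; rewrite ?end_mx_one_plusV // end_mxD end_mx1.
Qed.

End AutMatrix.

Lemma generated_fg_eval (T : choiceType) (G : groupType) (f : T -> G)
    (S : G -> Prop) (S_f : forall g, S g <-> exists x, f x = g) g :
  generated S g <-> exists w, fg_eval f w = g.
Proof.
split=> [gen_g | [[w rw] <-] H SH H1 HM HV].
  apply: (gen_g (fun h => exists w, fg_eval f w = h))
    => [x /S_f[i <-]||x y [u <-] [v <-]|x [u <-]].
  - by exists (fg_gen i); apply: fg_eval_gen.
  - by exists 1%g.
  - by exists (u * v)%g; rewrite gmulfM.
  - by exists (u^-1)%g; rewrite gmulfV.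
rewrite /fg_eval /= {rw}; elim: w => //= l w IHw; apply: HM => //.
have Hl : H (f l.1) by apply/SH/S_f; exists l.1.
by rewrite /letter_eval; case: l.2 => //; apply: HV.
Qed.

Theorem lemma5p1 (K : fieldType) (charK0 : [pchar K] =i pred0)
    (V : vectType K) (A B : 'End(V))
    (hA : (A \o A)%VF = 0) (hB : (B \o B)%VF = 0)
    (htr : ~ algebraicOver (ratr : rat -> K) (lfun_trace (A \o B)%VF)) :
  free_of_rank 2 (generated (fun g : lin_aut V =>
                               g = one_plus hA \/ g = one_plus hB)).
Proof.
exists (fg_eval (unipotent_gen hA hB)); split; last first.
  apply: generated_fg_eval => g; split=> [[]->|[i <-]].
  - by exists 0.
  - by exists 1.
  - by rewrite /unipotent_gen; case: (i == 0); [left | right].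
have ker1 u : fg_eval (unipotent_gen hA hB) u = 1%g -> u = 1%g.
  move=> u1; apply: val_inj.
  apply: (matrix_word_eq1 charK0 (a := end_mx A) (b := end_mx B)).
  - by rewrite -end_mx_comp hA end_mx0.
  - by rewrite -end_mx_comp hB end_mx0.
  - by rewrite -end_mx_comp end_mx_trace.
  - exact: wordP.
  - rewrite -(end_mx_word_eval hA hB) -[word_eval _ _]/(fg_eval _ u) u1.
    exact: end_mx1.
move=> u v uv; apply: (mulIg v^-1%g); rewrite mulgV; apply: ker1.
by rewrite gmulfM gmulfV uv mulgV.
Qed.
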